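(* Let $(\Sigma,\mathbb M)$ be a surface with marked points and non-empty boundary, and let $\tau$ be a valency $\geq3$-triangulation of $(\Sigma,\mathbb M)$. Let $G(\tau)$ be the associated graph, with sets $\mathbb W$, $\mathbb B$, $\mathbb G$ of white, black and grey vertices. Then $G(\tau)$ admits a partial matching that saturates all white and black vertices if and only if the following two conditions are simultaneously satisfied: (1) for any subset $S_1\subseteq\mathbb W$ there are at least $|S_1|$ elements of $\mathbb B\cup\mathbb G$ that are connected by an edge to some element of $S_1$; (2) for any subset $S_2\subseteq\mathbb B$ there are at least $|S_2|$ elements of $\mathbb W$ that are connected by an edge to some element of $S_2$. In particular, if there exists a partial matching that saturates all black and white vertices, then $|\mathbb B|\leq|\mathbb W|\leq|\mathbb B|+|\mathbb G|$.
   Context: A surface with marked points $(\Sigma,\mathbb M)$ is a compact connected oriented surface $\Sigma$ with a finite non-empty set $\mathbb M\subset\Sigma$ containing at least one point on each boundary component; points of $\mathbb M$ in the interior are called punctures. The closed sphere with at most three punctures, the once-punctured monogon and the unpunctured disc with at most three marked points are excluded. Arcs and ideal triangulations are as in Fomin–Shapiro–Thurston. The valency of a puncture is the number of arc-ends incident to it; a valency $\geq3$-triangulation is an ideal triangulation in which every puncture has valency at least $3$ (so there are no self-folded triangles). A triangle is internal if all three of its sides are arcs. The quiver $Q(\tau)$ has the arcs of $\tau$ as vertices and, for each triangle and each pair of its sides $i,j$ that are arcs with $j$ immediately following $i$ clockwise along the boundary of the triangle, one arrow $i\to j$, which sits at the angle of the triangle between $i$ and $j$; each triangle contains $0$, $1$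 or $3$ arrows. An arrow is ''shared by'' a triangle and a puncture if it lies in the triangle at an angle whose vertex is that puncture. The graph $G(\tau)$ (multiple edges allowed). Vertices: the set $\mathbb W$ of white vertices is in bijection with the union of the set of internal triangles of $\tau$ and the set of triangles with one side being a boundary segment and one vertex being a puncture; the set $\mathbb B$ of black vertices is in bijection with the set of punctures; the set $\mathbb G$ of grey vertices is in bijection with the union of the set of internal triangles that share at least one point with the boundary and the set of triangles with one side being a boundary segment and one vertex being a puncture. Edges: (a) for every arrow $\alpha$ shared by a puncture and a triangle, an edge $E_\alpha$ connecting the corresponding black and white vertices; (b) for every arrow $\alpha$ in an internal triangle and not shared by a puncture, an edge $E_\alpha$ connecting the grey and white vertices corresponding to this triangle; (c) for every triangle containing exactly one arrow $\alpha$, if $\alpha$ is shared by this triangle and a puncture, an edge $F_\alpha$ connecting the white and grey vertices corresponding to this triangle; and no other edges. A partial matching is a set of edges no two of which share a vertex; it saturates a vertex if that vertex belongs to one of its edges. *)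

(* Defs.v *)
(* MathComp-Analysis: the real line is an arbitrary [R : realType], the plane is
   [R * R] with the product topology. *)
From HB Require Import structures.
From mathcomp Require Import all_boot all_order all_algebra finmap.
From mathcomp Require Import all_classical all_reals all_analysis.

Set Implicit Arguments.
Unset Strict Implicit.
Unset Printing Implicit Defensive.

Import Order.TTheory GRing.Theory Num.Theory.
Import numFieldNormedType.Exports.

Local Open Scope classical_set_scope.
Local Open Scope ring_scope.

Section Plane.
Variable R : realType.
Implicit Types (z : R * R) (f : R * R -> R * R).

Definition half_plane : set (R * R) := [set z | 0 <= z.2].

Definition disc : set (R * R) := [set z | z.1 ^+ 2 + z.2 ^+ 2 <= 1].
Definition open_disc : set (R * R) := [set z | z.1 ^+ 2 + z.2 ^+ 2 < 1].
Definition circle : set (R * R) := [set z | z.1 ^+ 2 + z.2 ^+ 2 = 1].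
Definition upper_arc : set (R * R) := circle `&` [set z | 0 <= z.2].
Definition lower_arc : set (R * R) := circle `&` [set z | z.2 <= 0].
Definition sphere : set (R * R * R) :=
  [set z | z.1.1 ^+ 2 + z.1.2 ^+ 2 + z.2 ^+ 2 = 1].

Definition unit_square : set (R * R) :=
  [set z | 0 <= z.1 <= 1 /\ 0 <= z.2 <= 1].

(* The model triangle. Its corners are numbered counterclockwise, and side [k]
   runs from corner [k] to corner [k + 1 mod 3]. *)
Definition triangle : set (R * R) :=
  [set z | [/\ 0 <= z.1, 0 <= z.2 & z.1 + z.2 <= 1]].
Definition open_triangle : set (R * R) :=
  [set z | [/\ 0 < z.1, 0 < z.2 & z.1 + z.2 < 1]].
Definition corner (k : 'I_3) : R * R :=
  nth (0, 0) [:: (0, 0); (1, 0); (0, 1)] k.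
Definition open_side (k : 'I_3) : set (R * R) :=
  [set ((1 - s) * (corner k).1 + s * (corner (ordS k)).1,
        (1 - s) * (corner k).2 + s * (corner (ordS k)).2) | s in `]0, 1[].

(* The image under [f] of the counterclockwise circle of radius [r] about [z]
   avoids [f z] and has winding number 1 about it: [theta] and [rho] are
   polar coordinates of this image loop, centred at [f z]. *)
Definition winds_once f z (r : R) : Prop :=
  exists theta rho : R -> R,
    [/\ {within `[0, 2 * pi], continuous theta},
        theta (2 * pi) = theta 0 + 2 * pi &
        forall t, t \in `[0, 2 * pi] ->
          0 < rho t /\
          f (z.1 + r * cos t, z.2 + r * sin t) =
            ((f z).1 + rho t * cos (theta t), (f z).2 + rho t * sin (theta t))].

(* For a map that is continuous and injective near [z], this is local degree 1. *)
Definition preserves_orientation_at f z : Prop :=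
  \forall r \near 0^'+, winds_once f z r.

End Plane.

Arguments half_plane R : clear implicits.
Arguments disc R : clear implicits.
Arguments open_disc R : clear implicits.
Arguments circle R : clear implicits.
Arguments upper_arc R : clear implicits.
Arguments lower_arc R : clear implicits.
Arguments sphere R : clear implicits.
Arguments unit_square R : clear implicits.
Arguments triangle R : clear implicits.
Arguments open_triangle R : clear implicits.
Arguments corner R k : clear implicits.
Arguments open_side R k : clear implicits.

Section Surfaces.
Variable R : realType.

Record chart (S : topologicalType) := Chart {
  dom : set S;
  coord : S -> R * R;
  param : R * R -> S;
  dom_open : open dom;
  coord_open : exists2 V : set (R * R),
    open V & coord @` dom = V `&` half_plane R;
  coord_continuous : {within dom, continuous coord};
  param_continuous : {within coord @` dom, continuous param};
  coordK : forall p, dom p -> param (coord p) = p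
}.

(* Compact connected oriented topological surfaces, possibly with boundary. The
   orientation is carried by an atlas whose transition maps preserve the
   orientation of the plane at interior points of the half-plane. *)
Record surface := Surface {
  points :> topologicalType;
  atlas : set (chart points);
  surface_hausdorff : hausdorff_space points;
  surface_compact : compact [set: points];
  surface_connected : connected [set: points];
  atlas_cover : forall p : points, exists2 c, atlas c & dom c p;
  atlas_oriented : forall c d, atlas c -> atlas d ->
    forall p, dom c p -> dom d p -> 0 < (coord c p).2 ->
      preserves_orientation_at (coord d \o param c) (coord c p)
}.

Definition boundary (S : surface) : set S :=
  [set p | exists c, [/\ atlas c, dom c p & (coord c p).2 = 0]].

Definition homeomorphic_to (S T : topologicalType) (A : set T) : Prop :=
  exists (f : S -> T) (g : T -> S),
    [/\ continuous f, range f = A, {within A, continuous g} & cancel f g].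

Definition interior_points (S : surface) (M : {fset S}) : {fset S} :=
  [fset p in M | p \notin @boundary S]%fset.

Record marked_surface := MarkedSurface {
  underlying :> surface;
  marked : {fset underlying};
  marked_nonempty : marked != fset0;
  marked_boundary : forall p, boundary p ->
    exists2 m, m \in marked & connected_component (@boundary underlying) p m;
  not_small_sphere :
    ~ (homeomorphic_to underlying (sphere R) /\ (#|` marked| <= 3)%N);
  not_punctured_monogon :
    ~ [/\ homeomorphic_to underlying (disc R), #|` marked| = 2%N
        & #|` interior_points marked| = 1%N];
  not_small_disc :
    ~ [/\ homeomorphic_to underlying (disc R), (#|` marked| <= 3)%N
        & interior_points marked = fset0]
}.

Definition punctures (S : marked_surface) : {fset S} :=
  interior_points (marked S).

Definition boundary_segment (S : marked_surface) (I : set S) : Prop :=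
  exists2 p, (@boundary S `\` [set` marked S]) p &
    I = connected_component (@boundary S `\` [set` marked S]) p.

End Surfaces.

Section Arcs.
Variables (R : realType) (S : marked_surface R).
Implicit Types g h : R -> S.

Definition curve_interior g : set S := g @` `]0, 1[.

Definition cuts_out_unpunctured_monogon g : Prop :=
  exists f : R * R -> S,
    [/\ {within disc R, continuous f},
        {in disc R &, injective f},
        f @` circle R = g @` `[0, 1] &
        forall z, open_disc R z -> f z \notin marked S].

(* The other side of the digon is a boundary segment. The two corners of the
   digon, the images of (1, 0) and (-1, 0), may coincide in the surface. *)
Definition cuts_out_unpunctured_digon g : Prop :=
  exists f : R * R -> S,
    let D := disc R `\` [set (1, 0); (-1, 0)] in
    [/\ {within disc R, continuous f},
        {in D &, injective f},
        f @` upper_arc R = g @` `[0, 1],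
        f @` lower_arc R `<=` @boundary R S &
        forall z, D z -> f z \notin marked S].

Definition arc_curve g : Prop :=
  [/\ {within `[0, 1], continuous g},
      g 0 \in marked S /\ g 1 \in marked S,
      {in `]0, 1[ &, injective g},
      (forall t, t \in `]0, 1[ -> g t \notin marked S /\ ~ boundary (g t)) &
      ~ cuts_out_unpunctured_monogon g /\ ~ cuts_out_unpunctured_digon g].

(* Arcs are unoriented, so a curve is also isotopic to its reverse. *)
Definition isotopic g h : Prop :=
  exists H : R * R -> S,
    [/\ {within unit_square R, continuous H},
        (forall s, s \in `[0, 1] -> arc_curve (fun t => H (s, t))),
        (forall t, t \in `[0, 1] -> H (0, t) = g t) &
        (forall t, t \in `[0, 1] -> H (1, t) = h t) \/
        (forall t, t \in `[0, 1] -> H (1, t) = h (1 - t))].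

Definition noncrossing g h : Prop :=
  curve_interior g `&` curve_interior h = set0.

Definition compatible g h : Prop :=
  exists g' h', [/\ isotopic g g', isotopic h h' & noncrossing g' h'].

(* An ideal triangulation, i.e. a maximal collection of distinct pairwise
   compatible arcs (isotopy classes of curves), together with simultaneously
   noncrossing representatives [curve] of its arcs and the ideal triangles into
   which they cut the surface. A triangle [t] comes with an orientation-preserving
   map [tri_map t] from the model triangle; [side t k] is the arc that is its
   [k]-th side, or [None] if this side is a boundary segment. In a self-folded
   triangle two sides are the same arc. *)
Record ideal_triangulation := IdealTriangulation {
  arc : finType;
  curve : arc -> R -> S;
  curve_arc : forall a, arc_curve (curve a);
  curve_noncrossing : forall a b, a != b -> noncrossing (curve a) (curve b);
  curve_distinct : forall a b, isotopic (curve a) (curve b) -> a = b;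
  curve_maximal : forall g, arc_curve g ->
    (forall a, compatible g (curve a)) -> exists a, isotopic g (curve a);

  tri : finType;
  tri_map : tri -> R * R -> S;
  side : tri -> 'I_3 -> option arc;
  tri_map_continuous : forall t, {within triangle R, continuous (tri_map t)};
  tri_map_inj : forall t, {in open_triangle R &, injective (tri_map t)};
  tri_map_oriented : forall t c z,
    open_triangle R z -> atlas c -> dom c (tri_map t z) ->
      preserves_orientation_at (coord c \o tri_map t) z;
  tri_inj : injective (fun t => tri_map t @` open_triangle R);
  tri_components :
    let X := ~` (@boundary R S `|` \bigcup_a (curve a @` `[0, 1])) in
    range (fun t => tri_map t @` open_triangle R) =
      [set connected_component X x | x in X];
  tri_corner : forall t k, tri_map t (corner R k) \in marked S;
  tri_side_inj : forall t k, {in open_side R k &, injective (tri_map t)};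
  tri_side : forall t k,
    if side t k is Some a then
      tri_map t @` open_side R k = curve_interior (curve a)
    else boundary_segment (tri_map t @` open_side R k)
}.

End Arcs.

Local Close Scope classical_set_scope.

Section Quiver.
Variables (R : realType) (S : marked_surface R) (tau : ideal_triangulation S).

Definition valency (p : S) : nat :=
  (#|[set a : arc tau | curve a 0 == p]| + #|[set a : arc tau | curve a 1 == p]|)%N.

Definition valency_ge3 : Prop :=
  forall p, p \in punctures S -> (3 <= valency p)%N.

Definition tri_vertex (t : tri tau) (k : 'I_3) : S := tri_map t (corner R k).

Definition internal (t : tri tau) : bool := [forall k, side t k != None].

Definition meets_boundary (t : tri tau) : bool :=
  `[< exists2 z, triangle R z & boundary (tri_map t z) >].

(* A triangle with a boundary segment as a side and a puncture as a vertex. *)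
Definition boundary_punctured (t : tri tau) : bool :=
  [exists k, side t k == None] && [exists k, tri_vertex t k \in punctures S].

(* The arrow [(t, k, a, b)] goes from the arc [a] to the arc [b] and sits at
   the angle of [t] at corner [k]. The sides at corner [k] are [k - 1] and [k];
   since sides are numbered counterclockwise, [k - 1] follows [k] clockwise. *)
Definition is_arrow (x : tri tau * 'I_3 * arc tau * arc tau) : bool :=
  let: (t, k, a, b) := x in
  (side t k == Some a) && (side t (ord_pred k) == Some b).
Definition arrow : Type := {x : tri tau * 'I_3 * arc tau * arc tau | is_arrow x}.
HB.instance Definition _ := Finite.on arrow.

Definition arrow_source (al : arrow) : arc tau := (val al).1.2.
Definition arrow_target (al : arrow) : arc tau := (val al).2.
Definition arrow_tri (al : arrow) : tri tau := (val al).1.1.1.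
Definition arrow_vertex (al : arrow) : S :=
  tri_vertex (arrow_tri al) (val al).1.1.2.

Definition at_puncture (al : arrow) : bool := arrow_vertex al \in punctures S.

Definition only_arrow (al : arrow) : bool :=
  [forall be : arrow, (arrow_tri be == arrow_tri al) == (be == al)].

End Quiver.

Record multigraph := Multigraph {
  gvertex : finType;
  gedge : finType;
  ends : gedge -> {set gvertex};
  ends_card2 : forall e, #|ends e| = 2%N
}.

Section Matchings.
Variable G : multigraph.

Definition edge_connected (v w : gvertex G) : bool :=
  [exists e : gedge G, ends e == [set v; w]].

Definition partial_matching (P : {set gedge G}) : Prop :=
  forall e f, e \in P -> f \in P -> e != f -> [disjoint ends e & ends f].

Definition saturates (P : {set gedge G}) (v : gvertex G) : Prop :=
  exists2 e, e \in P & v \in ends e.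

End Matchings.

Section Graph.
Variables (R : realType) (S : marked_surface R) (tau : ideal_triangulation S).

Definition white : Type := {t : tri tau | internal t || boundary_punctured t}.
HB.instance Definition _ := Finite.on white.
Definition black : Type := punctures S.
HB.instance Definition _ := Finite.on black.
Definition grey : Type :=
  {t : tri tau | internal t && meets_boundary t || boundary_punctured t}.
HB.instance Definition _ := Finite.on grey.

Definition vertex : finType := (white + black + grey)%type.

Definition white_vertex (w : white) : vertex := inl (inl w).
Definition black_vertex (b : black) : vertex := inl (inr b).
Definition grey_vertex (g : grey) : vertex := inr g.

(* The vertices corresponding to a given triangle or point of the surface;
   each of these sets has at most one element. *)
Definition white_of (t : tri tau) : {set vertex} :=
  [set white_vertex w | w : white & val w == t].
Definition black_of (p : S) : {set vertex} :=
  [set black_vertex b | b : black & val b == p].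
Definition grey_of (t : tri tau) : {set vertex} :=
  [set grey_vertex g | g : grey & val g == t].

(* [inl al] is the edge E_al, [inr al] is the edge F_al. *)
Definition is_edge (e : arrow tau + arrow tau) : bool :=
  match e with
  | inl al => at_puncture al || internal (arrow_tri al)
  | inr al => only_arrow al && at_puncture al
  end.
Definition edge : Type := {e : arrow tau + arrow tau | is_edge e}.
HB.instance Definition _ := Finite.on edge.

Definition edge_ends (e : edge) : {set vertex} :=
  match val e with
  | inl al =>
      if at_puncture al then black_of (arrow_vertex al) :|: white_of (arrow_tri al)
      else grey_of (arrow_tri al) :|: white_of (arrow_tri al)
  | inr al => white_of (arrow_tri al) :|: grey_of (arrow_tri al)
  end.

Lemma card_white_of t : internal t || boundary_punctured t -> #|white_of t| = 1%N.
Proof.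
move=> wt; rewrite (_ : white_of t = [set white_vertex (Sub t wt)]) ?cards1//.
apply/setP => v; rewrite inE; apply/imsetP/eqP => [[w + ->]|->].
  by rewrite inE => /eqP wt'; congr white_vertex; apply: val_inj.
by exists (Sub t wt) => //; rewrite inE.
Qed.

Lemma card_grey_of t :
  internal t && meets_boundary t || boundary_punctured t -> #|grey_of t| = 1%N.
Proof.
move=> gt; rewrite (_ : grey_of t = [set grey_vertex (Sub t gt)]) ?cards1//.
apply/setP => v; rewrite inE; apply/imsetP/eqP => [[w + ->]|->].
  by rewrite inE => /eqP wt'; congr grey_vertex; apply: val_inj.
by exists (Sub t gt) => //; rewrite inE.
Qed.

Lemma card_black_of p : p \in punctures S -> #|black_of p| = 1%N.
Proof.
move=> bp; rewrite (_ : black_of p = [set black_vertex [` bp]%fset]) ?cards1//.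
apply/setP => v; rewrite inE; apply/imsetP/eqP => [[w + ->]|->].
  by rewrite inE => /eqP wt'; congr black_vertex; apply: val_inj.
by exists [` bp]%fset => //; rewrite inE.
Qed.

Lemma black_white_disjoint p t : black_of p :&: white_of t = finset.set0.
Proof.
by apply/setP => v; rewrite !inE; apply/andP => -[/imsetP[b _ ->] /imsetP[]].
Qed.

Lemma grey_white_disjoint t u : grey_of t :&: white_of u = finset.set0.
Proof.
by apply/setP => v; rewrite !inE; apply/andP => -[/imsetP[b _ ->] /imsetP[]].
Qed.

Lemma not_internal_boundary_punctured (al : arrow tau) :
  at_puncture al -> ~~ internal (arrow_tri al) -> boundary_punctured (arrow_tri al).
Proof.
move=> alp; rewrite negb_forall => /existsP[k]; rewrite negbK => sk.
by apply/andP; split; apply/existsP; [exists k | exists (val al).1.1.2].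
Qed.

Lemma corner_triangle k : triangle R (corner R k).
Proof.
by case: k => -[|[|[|//]]] i; split; rewrite /corner /= ?addr0 ?add0r ?ler01.
Qed.

Lemma internal_meets_boundary (al : arrow tau) :
  ~~ at_puncture al -> meets_boundary (arrow_tri al).
Proof.
rewrite /at_puncture /arrow_vertex /tri_vertex.
set t := arrow_tri al; set k := (val al).1.1.2.
rewrite !inE /= tri_corner /= negbK inE => bd.
by exists (corner R k) => //; exact: corner_triangle.
Qed.

Lemma only_arrow_not_internal (al : arrow tau) :
  only_arrow al -> ~~ internal (arrow_tri al).
Proof.
move=> /forallP alone; apply/negP => /forallP int.
pose t := arrow_tri al; pose k := ordS (val al).1.1.2.
case Ea : (side t k) (int k) => [a|] // _.
case Eb : (side t (ord_pred k)) (int (ord_pred k)) => [b|] // _.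
have be_arrow : is_arrow (t, k, a, b) by rewrite /= Ea Eb !eqxx.
have := alone (Sub _ be_arrow); rewrite {1}/arrow_tri SubK eqxx eq_sym eqb_id.
move=> /eqP/(congr1 (fun be : arrow tau => (val be).1.1.2)) /=.
by rewrite /k; case: ((val al).1.1.2) => [[|[|[|]]]] //= ? /(congr1 val).
Qed.

Lemma edge_ends_card2 (e : edge) : #|edge_ends e| = 2%N.
Proof.
case: e => -[al|al] He; rewrite /edge_ends /=; rewrite /= in He.
  have wal : internal (arrow_tri al) || boundary_punctured (arrow_tri al).
    case: (boolP (internal _)) He => //= nint; rewrite orbF => alp.
    exact: not_internal_boundary_punctured.
  case: ifPn He => [alp _|nalp /= int].
    by rewrite cardsU black_white_disjoint cards0 subn0 card_black_of// card_white_of.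
  rewrite cardsU grey_white_disjoint cards0 subn0 card_white_of// card_grey_of//.
  by rewrite int internal_meets_boundary.
case/andP: He => /only_arrow_not_internal nint alp.
have bpt := not_internal_boundary_punctured alp nint.
rewrite finset.setUC cardsU grey_white_disjoint cards0 subn0.
by rewrite card_white_of ?card_grey_of ?bpt ?orbT.
Qed.

Definition graph : multigraph := Multigraph edge_ends_card2.

Definition whites : {set gvertex graph} := [set white_vertex w | w : white].
Definition blacks : {set gvertex graph} := [set black_vertex b | b : black].
Definition greys : {set gvertex graph} := [set grey_vertex g | g : grey].

End Graph.

(* Main.v *)
Require Import Defs.
From HB Require Import structures.
From mathcomp Require Import all_boot all_order all_algebra finmap.
From mathcomp Require Import all_classical all_reals all_analysis.
From mathcomp Require Import zify.
Import fintype boot.finset.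

Set Implicit Arguments.
Unset Strict Implicit.
Unset Printing Implicit Defensive.

(* Every edge of the graph joins a white vertex to a black or grey one. By Hall's
   theorem, (1) gives a matching that saturates all white vertices and (2) one
   that saturates all black vertices. By the Mendelsohn-Dulmage theorem the two
   can be spliced into one matching that saturates both colours. *)

(** * Hall's marriage theorem, by Rado's deletion argument *)

Section Hall.
Variables X Y : finType.
Implicit Types (F : X -> {set Y}) (A : {set X}).

Definition hall_condition F A : bool :=
  [forall (T : {set X} | T \subset A), #|T| <= #|\bigcup_(x in T) F x|].

Lemma hall_conditionPn F A :
  reflect (exists2 T : {set X}, T \subset A & #|\bigcup_(x in T) F x| < #|T|)
          (~~ hall_condition F A).
Proof.
rewrite negb_forall; apply: (iffP existsP) => -[T].
  by rewrite negb_imply -ltnNge => /andP[]; exists T.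
by exists T; rewrite negb_imply -ltnNge; apply/andP.
Qed.

Definition delete F x y := fun z => if z == x then F z :\ y else F z.

(* Two violating sets for the two deletions would, by submodularity of
   [T |-> #|\bigcup_(x in T) F x|], yield a violating set for [F]. *)
Lemma hall_condition_delete F A x y1 y2 : x \in A -> y1 != y2 ->
  hall_condition F A ->
  hall_condition (delete F x y1) A || hall_condition (delete F x y2) A.
Proof.
move=> xA y12 /forall_inP hallF; apply: contraT; rewrite negb_or.
case/andP=> /hall_conditionPn[T1 T1A lt1] /hall_conditionPn[T2 T2A lt2].
(* Away from [x] the deletion agrees with [F], so a violating set must contain [x]. *)
have mem_deleted (T : {set X}) y : T \subset A ->
    #|\bigcup_(z in T) delete F x y z| < #|T| -> x \in T.
  move=> TA; apply: contraTT => xT; rewrite -leqNgt.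
  rewrite (eq_bigr F) ?hallF// => z zT; rewrite /delete.
  by case: eqVneq zT xT => // -> ->.
have xT1 := mem_deleted _ _ T1A lt1; have xT2 := mem_deleted _ _ T2A lt2.
set U1 := \bigcup_(z in T1) _ in lt1; set U2 := \bigcup_(z in T2) _ in lt2.
have subU : \bigcup_(z in T1 :|: T2) F z \subset U1 :|: U2.
  apply/subsetP => y /bigcupP[z zT yz]; rewrite inE.
  case: (eqVneq z x) yz => [->|zx] yz.
    (* A point of [F x] cannot equal both [y1] and [y2], so it survives one of the deletions. *)
    case: (eqVneq y y1) => [yy1|yy1]; apply/orP; [right|left];
      apply/bigcupP; exists x => //; rewrite /delete eqxx !inE yz andbT //.
    by rewrite yy1.
  by move: zT; rewrite inE => /orP[] zT; apply/orP; [left|right];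
    apply/bigcupP; exists z => //; rewrite /delete (negPf zx).
(* Points of [F x] need not survive both deletions, so [x] is left out here. *)
have subI : \bigcup_(z in (T1 :&: T2) :\ x) F z \subset U1 :&: U2.
  apply/subsetP => y /bigcupP[z]; rewrite !inE => /and3P[zx zT1 zT2] yz.
  by apply/andP; split; apply/bigcupP; exists z; rewrite // /delete (negPf zx).
have T12A : T1 :|: T2 \subset A by rewrite subUset T1A.
have T12IA : (T1 :&: T2) :\ x \subset A.
  by apply/subsetP => z; rewrite !inE => /and3P[_ /(subsetP T1A)].
have leU := leq_trans (hallF _ T12A) (subset_leq_card subU).
have leI := leq_trans (hallF _ T12IA) (subset_leq_card subI).
(* The two strict violations give [#|U1| + #|U2| <= #|T1| + #|T2| - 2], while leaving out [x] costs
   the lower bound from Hall's condition only 1. *)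
have := cardsUI T1 T2; have := cardsUI U1 U2.
have := cardsD1 x (T1 :&: T2); rewrite inE xT1 xT2 /=.
lia.
Qed.

(* [f0] only provides junk values outside [A]. *)
Lemma hall_marriage F A (f0 : X -> Y) : hall_condition F A ->
  exists f : X -> Y, {in A &, injective f} /\ {in A, forall x, f x \in F x}.
Proof.
(* Induction on the total size of the family: points are deleted until no set has two. *)
have [n] := ubnP (\sum_(x in A) #|F x|); elim: n F => // n IHn F ltn hallF.
have [/exists_inP[x xA gt1]|/exists_inPn le1] :=
  boolP [exists x in A, 1 < #|F x|].
  have [y1 [y2 [y1F y2F y12]]] := card_gt1P gt1.
  have IH y : y \in F x -> hall_condition (delete F x y) A ->
      exists f, {in A &, injective f} /\ {in A, forall x, f x \in F x}.
    move=> yF /IHn[|f [injf fF]]; last first.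
      exists f; split=> // z /fF; rewrite /delete; case: eqP => // _.
      by rewrite inE => /andP[].
    rewrite ltnS in ltn; apply: leq_trans ltn.
    rewrite (bigD1 x xA) [X in _ < X](bigD1 x xA) /= /delete eqxx.
    rewrite (cardsD1 y (F x)) yF add1n addSn ltnS leq_add2l.
    by apply: leq_sum => z /andP[_ /negPf->].
  by case/orP: (hall_condition_delete xA y12 hallF); apply: IH.
(* Hall's condition on singletons excludes empty sets, so every set is now a singleton. *)
have F1 x : x \in A -> #|F x| = 1.
  move=> xA; apply/eqP; rewrite eqn_leq leqNgt le1//=.
  move/forall_inP: hallF => /(_ [set x]); rewrite sub1set cards1 => /(_ xA).
  by rewrite big_set1.
pose f x := odflt (f0 x) [pick y in F x].
have Ff x : x \in A -> F x = [set f x].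
  rewrite /f => /F1/eqP/cards1P[y ->].
  by case: pickP => [z|/(_ y)]; rewrite inE ?eqxx // => /eqP->.
exists f; split=> [x1 x2 x1A x2A eqf|x xA]; last by rewrite Ff ?inE.
(* Two distinct points with the same value would form a violating pair. *)
apply/eqP; move/forall_inP: hallF => /(_ [set x1; x2]).
rewrite subUset !sub1set x1A x2A => /(_ isT) leF; apply: contraTT leF => x12.
rewrite -ltnNge cards2 x12 ltnS /= -[X in _ <= X](cards1 (f x1)).
apply/subset_leq_card/bigcupsP => x.
by rewrite !inE => /orP[]/eqP->; rewrite Ff// eqf.
Qed.

End Hall.

(** * Splicing two injections *)

(* As in the Cantor-Bernstein theorem, [h] is the inverse of [g] on the image
   of a fixed point [D] of a monotone operator, and [f] elsewhere. *)
Lemma mendelsohn_dulmage (X Y : finType) (f : X -> Y) (g : Y -> X)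
    (A : {set X}) (C : {set Y}) :
  {in A &, injective f} -> {in C &, injective g} ->
  {in C, forall y, g y \in A} ->
  exists h : X -> Y,
    [/\ {in A &, injective h},
        {in A, forall x, h x = f x \/ h x \in C /\ g (h x) = x} &
        {in C, forall y, exists2 x, x \in A & h x = y}].
Proof.
move=> injf injg gCA.
pose Phi (D : {set Y}) := C :\: f @: (A :\: g @: D).
(* [D] sits under two complements, so the inclusion is reversed twice. *)
have Phi_mono : {homo Phi : D E / D \subset E}.
  by move=> D E DE; rewrite setDS// imsetS// setDS// imsetS.
pose D := fixset Phi; have defD : Phi D = D by apply: fixsetK.
have DC y : y \in D -> y \in C by rewrite -defD inE => /andP[].
pose h x := odflt (f x) [pick y in D | g y == x].
have hg y : y \in D -> h (g y) = y.
  move=> yD; rewrite /h; case: pickP => [z /andP[zD /eqP gzy]|/(_ y)] /=.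
    by apply: injg gzy; apply: DC.
  by rewrite yD eqxx.
have hf x : x \notin g @: D -> h x = f x.
  rewrite /h; case: pickP => // z /andP[zD /eqP <-].
  by rewrite imset_f.
(* By the fixed-point equation [D] avoids these values of [f], so the two branches of [h] never
   collide. *)
have fND x : x \in A -> x \notin g @: D -> f x \notin D.
  move=> xA xgD; rewrite -defD in_setD negb_and negbK.
  by rewrite imset_f// in_setD xgD.
exists h; split.
- move=> x1 x2 x1A x2A.
  case: (boolP (x1 \in g @: D)) => [/imsetP[y1 y1D ->]|x1D];
  case: (boolP (x2 \in g @: D)) => [/imsetP[y2 y2D ->]|x2D].
  + by rewrite !hg// => ->.
  + by rewrite hg// hf// => yf; rewrite yf (negPf (fND _ x2A x2D)) in y1D.
  + by rewrite hg// hf// => yf; rewrite -yf (negPf (fND _ x1A x1D)) in y2D.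
  + by rewrite !hf//; apply: injf.
- move=> x xA; case: (boolP (x \in g @: D)) => [|/hf]; last by left.
  by case/imsetP=> y yD ->; right; rewrite hg// DC.
- move=> y yC; case: (boolP (y \in D)) => [yD|].
    by exists (g y); rewrite ?gCA ?hg.
  (* By the same equation, a point of [C] outside [D] is a value of [f] at a point where [h] agrees
     with [f]. *)
  rewrite -defD in_setD yC andbT negbK => /imsetP[x].
  by rewrite in_setD => /andP[xgD xA] ->; exists x; rewrite ?hf.
Qed.

(** * Matchings in bipartite multigraphs *)

Section BipartiteMatchings.
Variable G : multigraph.
Implicit Types (A B C S : {set gvertex G}) (P : {set gedge G}).

Definition bipartition A B : Prop :=
  [disjoint A & B] /\
  forall e : gedge G, exists a b, [/\ a \in A, b \in B & ends e = [set a; b]].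

(** Unfolds to the sets counted in conditions (1) and (2). *)
Definition neighbours B S : {set gvertex G} :=
  [set v in B | [exists w in S, edge_connected w v]].

Lemma bipartitionC A B : bipartition A B -> bipartition B A.
Proof.
case=> dAB eAB; split=> [|e]; first by rewrite disjoint_sym.
have [a [b [aA bB ->]]] := eAB e.
by exists b, a; rewrite setUC.
Qed.

Lemma edge_connectedC (v w : gvertex G) :
  edge_connected v w = edge_connected w v.
Proof. by apply: eq_existsb => e; rewrite setUC. Qed.

Lemma bigcup_neighbours B S :
  \bigcup_(w in S) [set v in B | edge_connected w v] = neighbours B S.
Proof.
apply/setP => v; rewrite inE.
apply/bigcupP/andP => [[w wS]|[vB /exists_inP[w wS wv]]].
  by rewrite inE => /andP[-> wv]; split=> //; apply/exists_inP; exists w.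
by exists w; rewrite // inE vB.
Qed.

(** Necessity of Hall's condition: the edges of the matching inject [S] into its neighbours. *)
Lemma card_saturated_le A B P S :
  bipartition A B -> partial_matching P -> S \subset A ->
  {in S, forall v, saturates P v} -> #|S| <= #|neighbours B S|.
Proof.
move=> [dAB eAB] matP SA satS.
pose mate v := odflt v [pick w in B | [exists e in P, ends e == [set v; w]]].
have mateP v : v \in S ->
    mate v \in B /\ exists2 e, e \in P & ends e = [set v; mate v].
  move=> vS; rewrite /mate; case: pickP => [w|none].
    case/andP=> wB /exists_inP[e eP /eqP eE].
    by split=> //; exists e.
  have [e eP] := satS v vS; have [a [b [aA bB eE]]] := eAB e.
  rewrite eE !inE => /orP[]/eqP vE; last first.
    by move: (disjointFr dAB (subsetP SA v vS)); rewrite vE bB.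
  by have := none b; rewrite bB; case/exists_inP; exists e; rewrite ?eE ?vE.
have mate_inj : {in S &, injective mate}.
  move=> v1 v2 v1S v2S eq_mate.
  have [m1B [e1 e1P e1E]] := mateP v1 v1S.
  have [m2B [e2 e2P e2E]] := mateP v2 v2S.
  (* Matching edges that share an end coincide, and an edge has only one end in [A]. *)
  have eq_e : e1 = e2.
    apply/eqP; apply: contraTT isT => /(matP _ _ e1P e2P) dis.
    have : mate v1 \in ends e1 by rewrite e1E !inE eqxx orbT.
    by move/(disjointFr dis); rewrite e2E !inE eq_mate eqxx orbT.
  have : v1 \in ends e2 by rewrite -eq_e e1E !inE eqxx.
  rewrite e2E !inE => /orP[/eqP//|/eqP v1E].
  by have := disjointFr dAB (subsetP SA _ v1S); rewrite v1E m2B.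
rewrite -(card_in_imset mate_inj); apply/subset_leq_card/subsetP.
move=> _ /imsetP[v vS ->].
have [mB [e _ eE]] := mateP v vS; rewrite inE mB; apply/exists_inP.
by exists v => //; apply/existsP; exists e; rewrite eE.
Qed.

Lemma neighbours_hall A B :
  (forall S, S \subset A -> #|S| <= #|neighbours B S|) ->
  exists f : gvertex G -> gvertex G,
    {in A &, injective f} /\
    {in A, forall v, f v \in B /\ edge_connected v (f v)}.
Proof.
move=> hallA; pose F w := [set v in B | edge_connected w v].
have [|f [injf fF]] := @hall_marriage _ _ F A id.
  by apply/forall_inP => S SA; rewrite bigcup_neighbours hallA.
by exists f; split=> // v /fF; rewrite inE => /andP.
Qed.

(** Parallel edges may join [v] to [h v], so one is picked for each [v]. Picked edges are disjoint
    because [h] is injective and [A] does not meet [B]. *)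
Lemma matching_of_injection A B (h : gvertex G -> gvertex G) :
  [disjoint A & B] -> {in A &, injective h} ->
  {in A, forall v, h v \in B /\ edge_connected v (h v)} ->
  exists P, partial_matching P /\
    {in A, forall v, saturates P v /\ saturates P (h v)}.
Proof.
move=> dAB injh hB; pose e_ v := [pick e | ends e == [set v; h v]].
have e_P v : v \in A -> exists2 e, e_ v = Some e & ends e = [set v; h v].
  move=> /hB[_ /existsP[e eE]]; rewrite /e_; case: pickP => [e' /eqP|/(_ e)].
    by exists e'.
  by rewrite eE.
exists [set e | [exists v in A, e_ v == Some e]]; split=> [e1 e2|v vA]; last first.
  have [e ve eE] := e_P v vA.
  have eP : e \in [set e | [exists v in A, e_ v == Some e]].
    by rewrite inE; apply/exists_inP; exists v => //; apply/eqP.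
  by split; exists e => //; rewrite eE !inE eqxx ?orbT.
rewrite !inE => /exists_inP[v1 v1A /eqP e1v] /exists_inP[v2 v2A /eqP e2v] e12.
have [e1' + +] := e_P v1 v1A; rewrite e1v => -[<-] e1E.
have [e2' + +] := e_P v2 v2A; rewrite e2v => -[<-] e2E.
have v12 : v1 != v2.
  by apply: contraNN e12 => /eqP v12; move: e2v; rewrite -v12 e1v => -[->].
have [[h1B _] [h2B _]] := (hB v1 v1A, hB v2 v2A).
have neq a b : a \in A -> b \in B -> a != b.
  by move=> aA bB; apply: contraTN bB => /eqP<-; rewrite (disjointFr dAB).
rewrite e1E e2E disjoint_subset; apply/subsetP => v.
rewrite !inE negb_or => /orP[]/eqP->; first by rewrite v12 neq.
rewrite eq_sym neq//=; apply: contraNN v12 => /eqP/injh eqv.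
by rewrite eqv.
Qed.

(** [C] is the part of [B] to be saturated: the black vertices in the application, where grey ones
    may stay unmatched. *)
Lemma bipartite_matching A B C : bipartition A B -> C \subset B ->
  (exists P, partial_matching P /\ forall v, v \in A :|: C -> saturates P v) <->
  (forall S, S \subset A -> #|S| <= #|neighbours B S|) /\
  (forall S, S \subset C -> #|S| <= #|neighbours A S|).
Proof.
move=> bipAB CB; split=> [[P [matP satP]]|[hallA hallC]].
  split=> S SA.
    apply: (card_saturated_le bipAB matP SA) => v vS.
    by apply: satP; rewrite inE (subsetP SA).
  have SB := subset_trans SA CB.
  apply: (card_saturated_le (bipartitionC bipAB) matP SB) => v vS.
  by apply: satP; rewrite inE (subsetP SA) ?orbT.
have [f [injf fB]] := neighbours_hall hallA.
have [g [injg gA]] := neighbours_hall hallC.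
have gCA : {in C, forall w, g w \in A} by move=> w /gA[].
have [h [injh hfg hC]] := mendelsohn_dulmage injf injg gCA.
have [|P [matP satP]] := matching_of_injection (proj1 bipAB) injh (B := B).
  (* The edge comes from [f], or from [g] with its ends exchanged. *)
  move=> v vA; case: (hfg v vA) => [->|[hvC ghv]]; first exact: fB.
  split; first exact: (subsetP CB).
  by rewrite edge_connectedC -{2}ghv; case: (gA _ hvC).
exists P; split=> // v; rewrite inE => /orP[/satP[]//|/hC[w wA <-]].
by case: (satP w wA).
Qed.

End BipartiteMatchings.

(** * Bipartiteness of the graph of a triangulation *)

Lemma card_fiber_le1 (T V : finType) (U : eqType) (p : T -> U) (F : T -> V) u :
  injective p -> #|[set F x | x in T & p x == u]| <= 1.
Proof.
move=> injp; apply: leq_trans (leq_imset_card _ _) _; apply/card_le1_eqP => x y.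
by rewrite !inE => /eqP<- /eqP/injp.
Qed.

Section GraphBipartition.
Variables (R : realType) (S : marked_surface R) (tau : ideal_triangulation S).

(** The ends of an edge form the union of a white set and a black or grey set, each with at most one
    element. Since there are two ends, both sets are singletons. *)
Lemma graph_bipartition : bipartition (whites tau) (blacks tau :|: greys tau).
Proof.
split=> [|e].
  rewrite disjoint_subset; apply/subsetP => _ /imsetP[w _ ->].
  by rewrite !inE negb_or; apply/andP; split; apply/imsetP => -[].
have [t [U [leU UB eE]]] : exists (t : tri tau) (U : {set vertex tau}), [/\ #|U| <= 1,
    U \subset blacks tau :|: greys tau & edge_ends e = white_of t :|: U].
  have blackP (p : S) : black_of tau p \subset blacks tau :|: greys tau.
    by apply/subsetP => v /imsetP[b _ ->]; rewrite inE imset_f.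
  have greyP (t : tri tau) : grey_of t \subset blacks tau :|: greys tau.
    by apply/subsetP => v /imsetP[g _ ->]; rewrite inE orbC imset_f.
  have black1 (p : S) : #|black_of tau p| <= 1 by exact: card_fiber_le1 val_inj.
  have grey1 (t : tri tau) : #|grey_of t| <= 1 by exact: card_fiber_le1 val_inj.
  rewrite /edge_ends; case: (val e) => al; exists (arrow_tri al); last first.
    by exists (grey_of (arrow_tri al)).
  case: ifP => _.
    by exists (black_of tau (arrow_vertex al)); split; rewrite // setUC.
  by exists (grey_of (arrow_tri al)); split; rewrite // setUC.
have leW : #|white_of t| <= 1 by exact: card_fiber_le1 val_inj.
have := (leq_card_setU (white_of t) U).1; rewrite -eE edge_ends_card2 => le2.
have /eqP/cards1P[w wE] : #|white_of t| = 1 by lia.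
have /eqP/cards1P[v vE] : #|U| = 1 by lia.
exists w, v; split; last by rewrite /= eE wE vE.
  have : w \in white_of t by rewrite wE inE.
  by case/imsetP => x _ ->; apply: imset_f.
by apply: (subsetP UB); rewrite vE inE.
Qed.

End GraphBipartition.

Theorem theorem6p7 (R : realType) (S : marked_surface R)
    (S_boundary : exists p, @boundary R S p)
    (tau : ideal_triangulation S) (tau_valency : valency_ge3 tau) :
  ((exists P : {set gedge (graph tau)},
      partial_matching P /\
      forall v, v \in whites tau :|: blacks tau -> saturates P v) <->
   ((forall S1 : {set gvertex (graph tau)}, S1 \subset whites tau ->
       #|S1| <= #|[set v in blacks tau :|: greys tau |
                     [exists w in S1, edge_connected w v]]|) /\
    (forall S2 : {set gvertex (graph tau)}, S2 \subset blacks tau ->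
       #|S2| <= #|[set v in whites tau | [exists b in S2, edge_connected b v]]|))) /\
  ((exists P : {set gedge (graph tau)},
      partial_matching P /\
      forall v, v \in whites tau :|: blacks tau -> saturates P v) ->
   #|blacks tau| <= #|whites tau| /\
   #|whites tau| <= #|blacks tau| + #|greys tau|).

Proof.
have matching := bipartite_matching (graph_bipartition tau) (subsetUl _ _).
(* The bounds are conditions (1) and (2) for the full sets of white and of black vertices. *)
split=> // /matching[/(_ _ (subxx _)) leW /(_ _ (subxx _)) leB].
split.
  apply: leq_trans leB _.
  by apply/subset_leq_card/subsetP => v; rewrite inE => /andP[].
apply: leq_trans leW (leq_trans _ (leq_card_setU _ _)).
by apply/subset_leq_card/subsetP => v; rewrite inE => /andP[].
Qed.
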